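(* Let $p$ be an integer. For any non-negative integer $n$, $$\sum_{k=0}^{n}\genfrac{[}{]}{0pt}{}{n+1}{k+1}B_{k}^{(p)}=n!\,H_{n+1}^{(p)}.$$
   Context: $H_n^{(p)}=\sum_{k=1}^n 1/k^p$ are the generalized harmonic numbers. $\genfrac{[}{]}{0pt}{}{n}{k}$ are the (unsigned) Stirling numbers of the first kind, so that $(x+1)(x+2)\cdots(x+n)=\sum_{k=0}^{n}\genfrac{[}{]}{0pt}{}{n+1}{k+1}x^{k}$. The poly-Bernoulli numbers $B_k^{(p)}$ are defined by $\sum_{n=0}^{\infty}B_{n}^{(p)}\frac{t^{n}}{n!}=\frac{\mathrm{Li}_{p}(1-e^{-t})}{1-e^{-t}}$, where $\mathrm{Li}_p(t)=\sum_{n=1}^{\infty}t^n/n^p$ (as formal power series). *)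

(* Defs.v *)
From mathcomp Require Import all_boot all_order all_algebra.

Set Implicit Arguments.
Unset Strict Implicit.
Unset Printing Implicit Defensive.

Import Order.TTheory GRing.Theory Num.Theory.
Local Open Scope ring_scope.

Definition harmonic (p : int) (n : nat) : rat :=
  \sum_(1 <= k < n.+1) 1 / (k%:R ^ p).

(* Defined by x(x+1)...(x+n-1) = \sum_k [n, k] x^k; lemma [stirling1_shift] is
   the equivalent form for (x+1)...(x+n). *)
Definition stirling1 (n k : nat) : nat :=
  ((\prod_(0 <= i < n) ('X + i%:P) : {poly nat})`_k)%R.

(* A formal power series over Q is its sequence of coefficients. *)
Definition fps : Type := nat -> rat.

Definition fps_mul (f g : fps) : fps :=
  fun n => \sum_(i < n.+1) f i * g (n - i)%N.

Definition fps_pow (f : fps) (k : nat) : fps :=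
  iter k (fps_mul f) (fun n => (n == 0%N)%:R).

(* Meaningful when g 0 = 0: then g^k has no term of degree < k, so the
   coefficient of degree n only involves k <= n. *)
Definition fps_comp (f g : fps) : fps :=
  fun n => \sum_(k < n.+1) f k * fps_pow g k n.

(* Long division, for g 0 <> 0: with c = f(0) / g(0),
   f / g = c + t * (((f - c g) / t) / g). *)
Fixpoint fps_div0 (f g : fps) (n : nat) : rat :=
  let c := f 0%N / g 0%N in
  if n is m.+1 then fps_div0 (fun i => f i.+1 - c * g i.+1) g m else c.

(* The quotient f / g when f 0 = g 0 = 0 and g 1 <> 0, obtained by cancelling
   a factor t. *)
Definition fps_div (f g : fps) : fps :=
  fps_div0 (fun n => f n.+1) (fun n => g n.+1).

Definition fps_egf (a : nat -> rat) : fps := fun n => a n / n`!%:R.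

Definition polylog (p : int) : fps :=
  fun n => if n == 0%N then 0 else 1 / (n%:R ^ p).

(* 1 - e^{-t} *)
Definition one_sub_expN : fps :=
  fun n => (n == 0%N)%:R - (-1) ^+ n / n`!%:R.

Definition polyBernoulli (p : int) (n : nat) : rat :=
  n`!%:R * fps_div (fps_comp (polylog p) one_sub_expN) one_sub_expN n.

Lemma stirling1_shift (n : nat) :
  \prod_(1 <= i < n.+1) ('X + i%:R%:P) =
  \sum_(0 <= k < n.+1) (stirling1 n.+1 k.+1)%:R *: 'X^k :> {poly rat}.
Proof.
have E : \prod_(0 <= i < n.+1) ('X + i%:R%:P) =
    map_poly (GRing.natmul 1) (\prod_(0 <= i < n.+1) ('X + i%:P) : {poly nat}) :> {poly rat}.
  rewrite rmorph_prod; apply: eq_bigr => i _.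
  by rewrite rmorphD /= map_polyX map_polyC.
have sz : size (\prod_(1 <= i < n.+1) ('X + i%:R%:P) : {poly rat}) = n.+1.
  under eq_bigr => i _ do rewrite -[i%:R%:P]opprK -polyCN.
  by rewrite size_prod_XsubC size_iota subSS subn0.
rewrite -[LHS]coefK sz poly_def big_mkord; apply: eq_bigr => k _; congr (_ *: _).
transitivity ((\prod_(0 <= i < n.+1) ('X + i%:R%:P) : {poly rat})`_k.+1).
  by rewrite [in RHS]big_ltn // mulr0n polyC0 addr0 coefXM.
by rewrite E coef_map.
Qed.

Lemma fps_div0P (f g : fps) : g 0%N != 0 -> fps_mul (fps_div0 f g) g =1 f.
Proof.
move=> g0 n; elim: n f => [|n IHn] f.
  by rewrite /fps_mul big_ord1 /= divfK.
rewrite /fps_mul big_ord_recl /= subn0.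
under eq_bigr => i _ do rewrite /= /bump add1n subSS.
rewrite -/(fps_div0 _ _) [X in _ + X](IHn (fun i => f i.+1 - f 0%N / g 0%N * g i.+1)).
by rewrite addrC subrK.
Qed.

(* The defining generating function, with the denominator multiplied out; it
   determines polyBernoulli p since 1 - e^{-t} is nonzero. *)
Lemma polyBernoulli_egf (p : int) :
  fps_mul (fps_egf (polyBernoulli p)) one_sub_expN
    =1 fps_comp (polylog p) one_sub_expN.
Proof.
have u0 : one_sub_expN 0 = 0 by [].
have u1 : one_sub_expN 1 != 0 by [].
have egfK n : fps_egf (polyBernoulli p) n =
    fps_div (fps_comp (polylog p) one_sub_expN) one_sub_expN n.
  by rewrite /fps_egf /polyBernoulli mulrAC divff ?mul1r // pnatr_eq0 -lt0n fact_gt0.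
case=> [|n].
  by rewrite /fps_mul /fps_comp !big_ord1 /= subnn u0 mulr0 mul0r.
rewrite /fps_mul big_ord_recr /= subnn u0 mulr0 addr0.
rewrite -[RHS](fps_div0P (fun m => fps_comp _ _ m.+1)
  (g := fun m => one_sub_expN m.+1) u1 n).
by apply: eq_bigr => i _; rewrite egfK /= subSn // -ltnS.
Qed.

(* Main.v *)
Require Import Defs.
From mathcomp Require Import all_boot all_order all_algebra.

Set Implicit Arguments.
Unset Strict Implicit.
Unset Printing Implicit Defensive.

Import Order.TTheory GRing.Theory Num.Theory.
Local Open Scope ring_scope.

(** With [u = 1 - e^{-t}], the defining series gives
    [B_k^{(p)} = \sum_m S(k, m) / (m+1)^p] where [S(k, m) = k! [t^k] u^m].
    Since [u' = 1 - u], these numbers satisfy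
    [S(k+1, m+1) = (m+1) (S(k, m) - S(k, m+1))]; together with the recurrence of
    the Stirling numbers this yields, by induction on [n], that
    [\sum_k [n+1, k+1] S(k, m)] is [n!] if [m <= n] and [0] otherwise. *)

Lemma fps_mulC (f g : fps) : fps_mul f g =1 fps_mul g f.
Proof.
move=> n; rewrite /fps_mul (reindex_inj rev_ord_inj) /=.
by apply: eq_bigr => i _; rewrite subSS subKn 1?mulrC // -ltnS.
Qed.

(** As [g] has order exactly 1, coefficient [n.+1] of the product isolates [a n * g 1] once the
    earlier coefficients of [a] and [b] agree. *)
Lemma fps_mul_cancelr (a b g : fps) : g 0%N = 0 -> g 1%N != 0 ->
  fps_mul a g =1 fps_mul b g -> a =1 b.
Proof.
move=> g0 g1 eq_ab n; elim/ltn_ind: n => n IHn.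
have := eq_ab n.+1; rewrite /fps_mul !big_ord_recr /= subnn g0 !mulr0 !addr0.
rewrite subSnn (eq_bigr (fun i : 'I_n => b i * g (n.+1 - i)%N)) => [|i _].
  by move/addrI/(mulIf g1).
by rewrite IHn.
Qed.

(** Gives access to the polynomial derivative and its power rule. *)
Lemma fps_pow_trunc (f : fps) (N m k : nat) : (k < N)%N ->
  fps_pow f m k = ((\poly_(i < N) f i) ^+ m)`_k.
Proof.
elim: m k => [|m IHm] k ltkN; first by rewrite expr0 coef1.
rewrite exprS coefM /fps_pow iterS; apply: eq_bigr => i _.
rewrite coef_poly (leq_trans (ltn_ord i) ltkN).
by rewrite -IHm // (leq_ltn_trans (leq_subr _ _)).
Qed.

Local Notation u := one_sub_expN.

(** The differential equation [u' = 1 - u], read at [t^k]. *)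
Lemma one_sub_expN_deriv (k : nat) :
  u k.+1 *+ k.+1 = (k == 0%N)%:R - u k.
Proof.
rewrite /one_sub_expN sub0r opprB addrC subrK.
rewrite factS natrM exprS mulN1r mulNr opprK.
have k1 : k.+1%:R != 0 :> rat by rewrite pnatr_eq0.
by rewrite -[LHS]mulr_natl invfM mulrCA mulVKf.
Qed.

(* The derivative of [u^(m+1)] is [(m+1) u^m u' = (m+1) (u^m - u^(m+1))]. *)
Lemma one_sub_expN_pow_deriv (m k : nat) :
  fps_pow u m.+1 k.+1 *+ k.+1 = (fps_pow u m k - fps_pow u m.+1 k) *+ m.+1.
Proof.
(* Truncating at [k.+2] keeps degree [k.+1], which the derivative moves to [k]. *)
rewrite !(@fps_pow_trunc _ k.+2) //; set q := \poly_(i < _) _.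
rewrite -coef_deriv deriv_exp coefMn /= exprS -coefB.
congr (_ *+ _); have -> : q ^+ m - q * q ^+ m = (1 - q) * q ^+ m by rewrite mulrBl mul1r.
rewrite !coefM.
apply: eq_bigr => -[i /=]; rewrite ltnS => leik _; congr (_ * _).
by rewrite coef_deriv coefB coef1 !coef_poly !ltnS (leqW leik) leik one_sub_expN_deriv.
Qed.

Lemma fps_pow_one_sub_expN0 (m : nat) : fps_pow u m 0 = (m == 0%N)%:R.
Proof. by case: m => [|m] //; rewrite /fps_pow iterS /fps_mul big_ord1 mul0r. Qed.

Lemma fps_pow_one_sub_expN_eq0 (m k : nat) : (k < m)%N -> fps_pow u m k = 0.
Proof.
elim: k m => [|k IHk] [|m] // ltkm; first by rewrite fps_pow_one_sub_expN0.
have := one_sub_expN_pow_deriv m k; rewrite !IHk // 1?ltnW //.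
by rewrite subrr mul0rn => /eqP; rewrite mulrn_eq0 => /eqP.
Qed.

(** Termwise division of [Li_p(u)] by [u]. The free bound [N] lets all [k <= n] share one range of
    [m], so that sums can be exchanged. *)
Lemma polyBernoulliE (p : int) (N k : nat) : (k <= N)%N ->
  polyBernoulli p k =
    k`!%:R * \sum_(m < N.+1) 1 / m.+1%:R ^ p * fps_pow u m k.
Proof.
pose Q (M : nat) : fps := fun j => \sum_(m < M.+1) 1 / m.+1%:R ^ p * fps_pow u m j.
have QE M j : (j <= M)%N -> Q M j = Q j j.
  move=> lejM; rewrite /Q.
  rewrite [RHS](big_ord_widen M.+1 (fun m => 1 / m.+1%:R ^ p * fps_pow u m j)) //.
  rewrite [RHS]big_mkcond; apply: eq_bigr => m _.
  by case: ltnP => // /fps_pow_one_sub_expN_eq0 ->; rewrite mulr0.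
move=> lekN; rewrite -/(Q N k) QE //.
have fact0 j : j`!%:R != 0 :> rat by rewrite pnatr_eq0 -lt0n fact_gt0.
suff: fps_egf (polyBernoulli p) =1 fun j => Q j j.
  by move=> /(_ k) <-; rewrite /fps_egf mulrC divfK.
apply: (@fps_mul_cancelr _ _ u) => // n.
rewrite polyBernoulli_egf /fps_comp big_ord_recl {1}/polylog mul0r add0r.
(* The added term [m = n] vanishes, since [u^(n+1)] has order above [n]. *)
transitivity (\sum_(m < n.+1) 1 / m.+1%:R ^ p * fps_pow u m.+1 n).
  by rewrite [RHS]big_ord_recr fps_pow_one_sub_expN_eq0 // mulr0 [RHS]addr0.
rewrite /fps_mul.
under [RHS]eq_bigr => i _.
  rewrite -(QE n i (leq_ord i)) /Q big_distrl /=.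
over.
rewrite exchange_big; apply: eq_bigr => m _.
rewrite -[fps_pow u m.+1 n]/(fps_mul u (fps_pow u m) n) fps_mulC big_distrr /=.
by apply: eq_bigr => i _; rewrite mulrA.
Qed.

Lemma stirling1S (n k : nat) :
  stirling1 n.+1 k.+1 = (stirling1 n k + n * stirling1 n k.+1)%N.
Proof.
rewrite /stirling1 big_nat_recr //= mulrDr coefD coefMX coefMC /=.
by rewrite [(_ * n)%R]mulrC.
Qed.

Lemma stirling1S0 (n : nat) : stirling1 n.+1 0 = 0%N.
Proof. by rewrite /stirling1 big_ltn // polyC0 addr0 coefXM. Qed.

Lemma stirling1_eq0 (n k : nat) : (n < k)%N -> stirling1 n k = 0%N.
Proof.
elim: n k => [|n IHn] [|k] // ltnk; first by rewrite /stirling1 big_geq // coef1.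
by rewrite stirling1S !IHn ?muln0 // ltnW.
Qed.

Lemma sum_stirling1_pow (n m : nat) :
  \sum_(k < n.+1) (stirling1 n.+1 k.+1)%:R * (k`!%:R * fps_pow u m k)
    = n`!%:R * (m <= n)%:R.
Proof.
elim: n m => [|n IHn] m.
  rewrite big_ord1 fps_pow_one_sub_expN0 leqn0.
  by rewrite stirling1S {1}/stirling1 big_geq // coef1 mul0n addn0 mul1r.
pose S j k := k`!%:R * fps_pow u j k.
(* The Stirling recurrence; its first summand is reindexed by [k -> k+1]. *)
have -> : \sum_(k < n.+2) (stirling1 n.+2 k.+1)%:R * S m k =
    \sum_(k < n.+1) (stirling1 n.+1 k.+1)%:R * S m k.+1
    + n.+1%:R * \sum_(k < n.+1) (stirling1 n.+1 k.+1)%:R * S m k.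
  under eq_bigr => k _ do rewrite stirling1S natrD natrM mulrDl -mulrA.
  rewrite big_split /= big_ord_recl stirling1S0 mul0r add0r; congr (_ + _).
  by rewrite -mulr_sumr big_ord_recr /= [stirling1 _ n.+2]stirling1_eq0 // mul0r addr0.
(* For [m = 0] the shifted sum vanishes because [u^0 = 1]. *)
rewrite [in X in _ + X]IHn; case: m => [|m].
  rewrite big1 => [|k _]; last by rewrite /S mulr0 mulr0.
  by rewrite add0r factS natrM mulrA.
have SS k : S m.+1 k.+1 = m.+1%:R * (S m k - S m.+1 k).
  rewrite /S factS mulnC natrM -mulrA [k.+1%:R * _]mulr_natl one_sub_expN_pow_deriv.
  by rewrite -[_ *+ m.+1]mulr_natl mulrCA mulrBr.
under eq_bigr => k _ do rewrite SS mulrCA mulrBr.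
rewrite -mulr_sumr sumrB !IHn factS natrM ltnS.
(* The difference of the two indicators survives only at [m = n], where its factor [m+1] is the
   required [n+1]. *)
by case: ltngtP => [_|_|->]; rewrite ?mulr1 ?mulr0 ?subrr ?subr0 ?mulr0 ?add0r ?addr0.
Qed.

Theorem corollary2 (p : int) (n : nat) :
  \sum_(0 <= k < n.+1) (stirling1 n.+1 k.+1)%:R * polyBernoulli p k
    = n`!%:R * harmonic p n.+1.
Proof.
rewrite big_mkord /harmonic big_add1 big_mkord mulr_sumr.
under eq_bigr => k _ do rewrite (polyBernoulliE p (leq_ord k)) !mulr_sumr.
rewrite exchange_big; apply: eq_bigr => m _.
(* Here [m <= n], so the indicator is 1 and [n!] can be expanded back into the Stirling sum. *)
have /esym := sum_stirling1_pow n m; rewrite leq_ord mulr1 => ->.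
rewrite mulr_suml; apply: eq_bigr => k _.
by rewrite [1 / _ * _]mulrC !mulrA.
Qed.
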